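(* Let $n\ge 1$. For every integer partition $\lambda$ of length at most $n$ (padded with zeros to $\lambda=(\lambda_1,\ldots,\lambda_n)$), the following identities hold: \begin{align*} \mathrm{spz}_\lambda(z_1,\ldots,z_n) &=\frac{\det\bigl[\mathcal{U}_{\lambda_j+n-j}(z_k/2)\bigr]_{j,k=1}^n}{\det\bigl[\mathcal{U}_{n-j}(z_k/2)\bigr]_{j,k=1}^n} =\frac{\det\bigl[\mathcal{U}_{\lambda_j+n-j}(z_k/2)\bigr]_{j,k=1}^n}{\prod_{1\le j<k\le n}(z_j-z_k)},\\ \mathrm{oz}_\lambda(z_1,\ldots,z_n) &=\frac{\det\bigl[\mathcal{T}^{\mathrm{monic}}_{\lambda_j+n-j}(z_k)\bigr]_{j,k=1}^n}{\det\bigl[\mathcal{T}^{\mathrm{monic}}_{n-j}(z_k)\bigr]_{j,k=1}^n} =\frac{\det\bigl[\mathcal{T}^{\mathrm{monic}}_{\lambda_j+n-j}(z_k)\bigr]_{j,k=1}^n}{\prod_{1\le j<k\le n}(z_j-z_k)},\\ \mathrm{spz}^{\mathrm{odd}}_\lambda(z_1,\ldots,z_n) &=\frac{\det\bigl[\mathcal{U}^{(1)}_{\lambda_j+n-j}(z_k/2)\bigr]_{j,k=1}^n}{\det\bigl[\mathcal{U}^{(1)}_{n-j}(z_k/2)\bigr]_{j,k=1}^n} =\frac{\det\bigl[\mathcal{U}^{(1)}_{\lambda_j+n-j}(z_k/2)\bigr]_{j,k=1}^n}{\prod_{1\le j<k\le n}(z_j-z_k)},\\ \mathrm{oz}^{\mathrm{odd}}_\lambda(z_1,\ldots,z_n)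 &=\frac{\det\bigl[\mathcal{W}_{\lambda_j+n-j}(z_k/2)\bigr]_{j,k=1}^n}{\det\bigl[\mathcal{W}_{n-j}(z_k/2)\bigr]_{j,k=1}^n} =\frac{\det\bigl[\mathcal{W}_{\lambda_j+n-j}(z_k/2)\bigr]_{j,k=1}^n}{\prod_{1\le j<k\le n}(z_j-z_k)},\\ (-1)^{|\lambda|}\,\mathrm{oz}^{\mathrm{odd}}_\lambda(-z_1,\ldots,-z_n) &=\frac{\det\bigl[\mathcal{V}_{\lambda_j+n-j}(z_k/2)\bigr]_{j,k=1}^n}{\det\bigl[\mathcal{V}_{n-j}(z_k/2)\bigr]_{j,k=1}^n} =\frac{\det\bigl[\mathcal{V}_{\lambda_j+n-j}(z_k/2)\bigr]_{j,k=1}^n}{\prod_{1\le j<k\le n}(z_j-z_k)}. \end{align*}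
   Context: Identities are in the field of rational functions in independent variables $z_1,\ldots,z_n$ over $\mathbb{C}$. $|\lambda|$ is the sum of the parts of $\lambda$. Chebyshev polynomials: $\mathcal{T}_m,\mathcal{U}_m,\mathcal{V}_m,\mathcal{W}_m$ all satisfy the recurrence $X_m(u)=2u\,X_{m-1}(u)-X_{m-2}(u)$ ($m\ge 2$), with $X_0=1$ in all four cases and $\mathcal{T}_1(u)=u$, $\mathcal{U}_1(u)=2u$, $\mathcal{V}_1(u)=2u-1$, $\mathcal{W}_1(u)=2u+1$. Moreover $\mathcal{T}^{\mathrm{monic}}_m(u)=2\mathcal{T}_m(u/2)$ for $m>0$, $\mathcal{T}^{\mathrm{monic}}_0(u)=1$, and $\mathcal{U}^{(1)}_m=\sum_{k=0}^m\mathcal{U}_k$. $\operatorname{Sym}_N$ is the algebra of symmetric polynomials in $N$ variables over $\mathbb{C}$. For $P\in\operatorname{Sym}_{2n}$, $\Phi_n(P)$ is the unique $Q\in\operatorname{Sym}_n$ with $P(x_1,\ldots,x_n,x_1^{-1},\ldots,x_n^{-1})=Q(x_1+x_1^{-1},\ldots,x_n+x_n^{-1})$; for $P\in\operatorname{Sym}_{2n+1}$, $\Phi_n^{\mathrm{odd}}(P)$ is the unique $Q\in\operatorname{Sym}_n$ with $P(x_1,\ldots,x_n,x_1^{-1},\ldots,x_n^{-1},1)=Q(x_1+x_1^{-1},\ldots,x_n+x_n^{-1})$ (existence and uniqueness hold). Let $\mathrm{h}_k$ be the complete homogeneous symmetric functions ($\mathrm{h}_0=1$, $\mathrm{h}_k=0$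 for $k<0$). For a nonempty partition $\lambda$ of length $\ell(\lambda)$, the symplectic and orthogonal Schur functions are \[ \mathrm{sp}_\lambda=\tfrac12\det\bigl[\mathrm{h}_{\lambda_j-j+k}+\mathrm{h}_{\lambda_j-j-k+2}\bigr]_{j,k=1}^{\ell(\lambda)},\qquad \mathrm{o}_\lambda=\det\bigl[\mathrm{h}_{\lambda_j-j+k}-\mathrm{h}_{\lambda_j-j-k}\bigr]_{j,k=1}^{\ell(\lambda)}, \] and $\mathrm{sp}_\varnothing=\mathrm{o}_\varnothing=1$. A superscript $(N)$ denotes restriction of a symmetric function to $N$ variables. Put $\mathrm{spz}_\lambda=\Phi_n(\mathrm{sp}_\lambda^{(2n)})$, $\mathrm{oz}_\lambda=\Phi_n(\mathrm{o}_\lambda^{(2n)})$, $\mathrm{spz}^{\mathrm{odd}}_\lambda=\Phi^{\mathrm{odd}}_n(\mathrm{sp}_\lambda^{(2n+1)})$, $\mathrm{oz}^{\mathrm{odd}}_\lambda=\Phi^{\mathrm{odd}}_n(\mathrm{o}_\lambda^{(2n+1)})$. *)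

(* Defs.v *)
From Stdlib Require Import ClassicalEpsilon.
From mathcomp Require Import all_boot all_order all_algebra.
From mathcomp Require Import mpoly complex reals.

Set Implicit Arguments.
Unset Strict Implicit.
Unset Printing Implicit Defensive.

Import GRing.Theory.
Local Open Scope ring_scope.

Section Chebyshev.

Variable K : fieldType.

Fixpoint cheb (p1 : {poly K}) (m : nat) : {poly K} :=
  match m with
  | 0 => 1
  | 1 => p1
  | (m'.+1 as m1).+1 => 2 *: 'X * cheb p1 m1 - cheb p1 m'
  end.

Definition chebT (m : nat) : {poly K} := cheb 'X m.
Definition chebU (m : nat) : {poly K} := cheb (2 *: 'X) m.
Definition chebV (m : nat) : {poly K} := cheb (2 *: 'X - 1) m.
Definition chebW (m : nat) : {poly K} := cheb (2 *: 'X + 1) m.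

Definition chebTmonic (m : nat) : {poly K} :=
  if m == 0%N then 1 else 2 *: (chebT m \Po (2^-1 *: 'X)).

Definition chebU1 (m : nat) : {poly K} := \sum_(0 <= k < m.+1) chebU k.

End Chebyshev.

Arguments chebT {K} m.
Arguments chebU {K} m.
Arguments chebV {K} m.
Arguments chebW {K} m.
Arguments chebTmonic {K} m.
Arguments chebU1 {K} m.

(* A partition is the sequence of its (positive) parts, so that [size la] is
   its length, [nth 0 la] is its padding by zeros and [sumn la] is |la|. *)
Definition is_part (la : seq nat) : bool := sorted geq la && (0%N \notin la).

(* A symmetric function F is given by the family of its restrictions F^(N) to
   N variables, N being the first argument below.  Restriction is a ring
   morphism, hence commutes with the determinants. *)
Section SymmetricFunctions.

Variables (C : fieldType) (N : nat).

Definition hsym (k : int) : {mpoly C[N]} :=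
  match k with
  | Posz d => \sum_(m : 'X_{1..N < d.+1} | mdeg m == d) 'X_[m]
  | Negz _ => 0
  end.

(* In the next two determinants j and k start from 0, whence the [.+1]. *)
Definition spfun (la : seq nat) : {mpoly C[N]} :=
  if la is [::] then 1 else
  2^-1 *: \det (\matrix_(j < size la, k < size la)
    (hsym ((nth 0%N la j)%:Z - j.+1%:Z + k.+1%:Z)
     + hsym ((nth 0%N la j)%:Z - j.+1%:Z - k.+1%:Z + 2%:Z))).

Definition ofun (la : seq nat) : {mpoly C[N]} :=
  if la is [::] then 1 else
  \det (\matrix_(j < size la, k < size la)
    (hsym ((nth 0%N la j)%:Z - j.+1%:Z + k.+1%:Z)
     - hsym ((nth 0%N la j)%:Z - j.+1%:Z - k.+1%:Z))).

End SymmetricFunctions.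

Notation ratfun C n := {fraction {mpoly C[n]}}.

Section SymplecticAlphabet.

Variables (C : fieldType) (n : nat).

Definition ratC (c : C) : ratfun C n := tofrac (c%:MP_[n]).

Definition ratX (i : 'I_n) : ratfun C n := tofrac ('X_i : {mpoly C[n]}).

Definition peval N (P : {mpoly C[N]}) (a : 'I_N -> ratfun C n) : ratfun C n :=
  mmap ratC a P.

Definition alphabet (i : 'I_(n + n)) : ratfun C n :=
  match split i with
  | inl j => ratX j
  | inr j => (ratX j)^-1
  end.

Definition alphabet_odd (i : 'I_(n + n + 1)) : ratfun C n :=
  match split i with
  | inl j => alphabet j
  | inr _ => 1
  end.

(* [Q] exists and is unique when [P] is symmetric, as it is below; the value on
   other polynomials is irrelevant. *)
Definition Phi (P : {mpoly C[n + n]}) : {mpoly C[n]} :=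
  epsilon (inhabits 0) (fun Q : {mpoly C[n]} =>
    Q \is symmetric /\
    peval P alphabet = peval Q (fun i => ratX i + (ratX i)^-1)).

Definition Phi_odd (P : {mpoly C[n + n + 1]}) : {mpoly C[n]} :=
  epsilon (inhabits 0) (fun Q : {mpoly C[n]} =>
    Q \is symmetric /\
    peval P alphabet_odd = peval Q (fun i => ratX i + (ratX i)^-1)).

Definition spz (la : seq nat) : {mpoly C[n]} := Phi (spfun C (n + n) la).
Definition oz (la : seq nat) : {mpoly C[n]} := Phi (ofun C (n + n) la).
Definition spz_odd (la : seq nat) : {mpoly C[n]} :=
  Phi_odd (spfun C (n + n + 1) la).
Definition oz_odd (la : seq nat) : {mpoly C[n]} :=
  Phi_odd (ofun C (n + n + 1) la).

(* det [X_(la_j + n - j) (a_k)] for 1 <= j, k <= n *)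
Definition altdet (X : nat -> {poly ratfun C n}) (la : seq nat)
    (a : 'I_n -> ratfun C n) : ratfun C n :=
  \det (\matrix_(j < n, k < n) (X (nth 0 la j + n - j.+1)%N).[a k]).

End SymplecticAlphabet.

(* Main.v *)
Require Import Defs.
From mathcomp Require Import all_boot all_order all_algebra.
From mathcomp Require Import mpoly complex reals.
From Stdlib Require Import ClassicalEpsilon.
From mathcomp Require Import perm ring zify.

Set Implicit Arguments.
Unset Strict Implicit.
Unset Printing Implicit Defensive.

Import GRing.Theory.
Local Open Scope ring_scope.

(** Put q(z) = 1 - z t + t^2, so that (1 - x t)(1 - t/x) = q(x + 1/x).  In the
    alphabet x_i, 1/x_i the complete homogeneous functions h_k are therefore the
    coefficients of 1/D with D = prod_i q(z_i), and with the extra letter 1 they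
    are those of 1/D with D = (1 - t) prod_i q(z_i).  Hence every Jacobi-Trudi
    determinant in them is an explicit symmetric polynomial in the z_i.  As the
    elements x_i + 1/x_i are algebraically independent ([peval_zeta_inj]), this
    polynomial is the value of Phi ([spzE], [spz_oddE], [ozE], [oz_oddE]).

    The Chebyshev polynomials enter through their generating functions in t:
    sum_m U_m(z/2) t^m = 1/q(z),   sum_m Tmonic_m(z) t^m = (1 - t^2)/q(z),
    sum_m U1_m(z/2) t^m = 1/((1 - t) q(z)),
    sum_m W_m(z/2) t^m = (1 - t^2)/((1 - t) q(z)).
    So in the four cases the value X_m(z_r) is the coefficient of t^m in p c_r/D,
    where c_r is the product of the q(z_i) for i <> r, and p is 1 in the
    symplectic and 1 - t^2 in the orthogonal case.  Expanding the product of the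
    polynomial p c_r with the series 1/D gives
    X_m(z_r) = sum_i (p c_r)_i h_(m - i).  The polynomial c_r is palindromic of
    degree 2n - 2 and (1 - t^2) c_r is antipalindromic of degree 2n; folding the
    sum about its middle term leaves n terms, which pair the coefficients of
    p c_r with h_(m - n + k) + h_(m - n - k + 2), respectively with
    h_(m - n + k) - h_(m - n - k), for k = 1, .., n.  For m = la_j + n - j these
    are the entries of the Jacobi-Trudi matrix of la.  Thus the matrix
    X_(la_j + n - j)(z_r) is the product of that matrix and of one which does not
    depend on la ([det_bialternant_sp], [det_bialternant_o]), and comparing la
    with the empty partition gives the ratio of determinants.  The denominator
    is a Vandermonde determinant because X_m is monic of degree m in z
    ([det_monic_Vandermonde]).

    The matrix factorization holds at arbitrary points a_r instead of z_r.  At a_r = - z_r the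
    parity W_m(-u) = (-1)^m V_m(u) then gives the identity for V. *)

(** * Quotients of power series *)

Section SeriesQuotient.

Variable A : comNzRingType.
Implicit Types P Q E G H : {poly A}.

(** The coefficient of t^m in the power series P / E, when E has constant
    coefficient 1: modulo t^(m + 1), the inverse of E is the geometric sum of the
    powers of 1 - E, which is divisible by t. *)
Definition qser P E (m : nat) : A := (P * \sum_(i < m.+1) (1 - E) ^+ i)`_m.

Lemma geom_sumE E N : E * (\sum_(i < N) (1 - E) ^+ i) = 1 - (1 - E) ^+ N.
Proof.
have := subrX1 (1 - E) N; rewrite [1 - E - 1]addrAC subrr sub0r mulNr => e.
by rewrite -[RHS]opprB e opprK.
Qed.

Lemma coefM_geom E H N k : E`_0 = 1 -> (k < N)%N ->
  (H * (1 - (1 - E) ^+ N))`_k = H`_k.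
Proof.
move=> E0 ltkN; rewrite mulrBr mulr1 coefB.
have [D ->] : exists D, 1 - E = D * 'X.
  have: (1 - E)`_0 = 0 by rewrite coefB coef1 E0 subrr.
  elim/poly_ind: (1 - E) => [|p c _]; first by exists 0; rewrite mul0r.
  by rewrite coefD coefMX coefC add0r => ->; exists p; rewrite addr0.
by rewrite exprMn mulrA coefMXn ltkN subr0.
Qed.

(** A series G with E G = P has the coefficients of P / E; only the coefficients
    up to m are compared, so that G may be a truncation of the series. *)
Lemma qser_unique P E G m : E`_0 = 1 ->
  (forall k, (k <= m)%N -> (E * G)`_k = P`_k) -> qser P E m = G`_m.
Proof.
move=> E0 eqP; rewrite /qser; set S := \sum_(i < _) _.
have -> : (P * S)`_m = (E * G * S)`_m.
  rewrite !coefM; apply: eq_bigr => i _.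
  by rewrite eqP // -ltnS.
by rewrite mulrAC geom_sumE mulrC coefM_geom.
Qed.

Lemma qser_conv P Q E m : E`_0 = 1 ->
  qser (P * Q) E m = \sum_(i < m.+1) P`_i * qser Q E (m - i).
Proof.
move=> E0; rewrite {1}/qser -mulrA coefM; apply: eq_bigr => i _.
congr (_ * _); apply/esym/qser_unique => // k lek.
rewrite mulrCA geom_sumE coefM_geom //.
by rewrite ltnS (leq_trans lek) ?leq_subr.
Qed.

Lemma qser_cancel P E Q m : E`_0 = 1 -> Q`_0 = 1 ->
  qser (P * Q) (E * Q) m = qser P E m.
Proof.
move=> E0 Q0; apply: qser_unique => [|k lekm].
  by rewrite coefM big_ord1 E0 Q0 mulr1.
have -> S : E * Q * (P * S) = P * Q * (E * S).
  by rewrite mulrACA [RHS]mulrACA; congr (_ * _); rewrite mulrC.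
by rewrite geom_sumE coefM_geom.
Qed.

End SeriesQuotient.

Lemma rmorph_qser (A B : comNzRingType) (f : {rmorphism A -> B}) P E m :
  f (qser P E m) = qser (map_poly f P) (map_poly f E) m.
Proof.
rewrite /qser -coef_map rmorphM rmorph_sum /=; congr (polyseq (_ * _))`__.
by apply: eq_bigr => i _; rewrite rmorphXn rmorphB rmorph1.
Qed.

(** * Complete homogeneous symmetric polynomials *)

(** Each factor 1 / (1 - a_i t) is a geometric series, truncated here at t^d:
    multiplying it back leaves 1 - (a_i t)^(d + 1), which is invisible up to t^d.
    Expanding the product of these sums lists the monomials of degree d. *)
Lemma qser_prod_linear (A : comNzRingType) N (a : 'I_N -> A) d :
  qser 1 (\prod_(i < N) (1 - (a i)%:P * 'X)) d =
  \sum_(f : {ffun 'I_N -> 'I_d.+1} | (\sum_i f i)%N == d) \prod_i a i ^+ f i.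
Proof.
pose near1 (p : {poly A}) :=
  forall k, (k <= d)%N -> p`_k = (1 : {poly A})`_k.
have near1M p q : near1 p -> near1 q -> near1 (p * q).
  move=> hp hq k lekd; rewrite -[in RHS](mulr1 1) !coefM.
  apply: eq_bigr => i _; have leik : (i <= k)%N by rewrite -ltnS.
  by rewrite hp ?hq // (leq_trans _ lekd) ?leq_subr.
pose F (i : 'I_N) (k : 'I_d.+1) : {poly A} := ((a i)%:P * 'X) ^+ k.
rewrite (qser_unique (G := \prod_i \sum_k F i k)); last first.
- rewrite -big_split; apply: (big_ind near1) => //= i _ k lekd.
  have := subrX1 ((a i)%:P * 'X) d.+1.
  rewrite -(opprB 1 (_ * 'X)) mulNr => /(congr1 -%R); rewrite opprK => <-.
  by rewrite opprB exprMn coefB coefMXn ltnS lekd subr0.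
- rewrite coef0_prod big1 // => i _.
  by rewrite coefB coef1 coefMX subr0.
rewrite bigA_distr_bigA /= coef_sum [RHS]big_mkcond; apply: eq_bigr => f _.
under eq_bigr do rewrite /F exprMn -rmorphXn /=.
rewrite big_split /= -rmorph_prod /= prodrXr coefCM coefXn eq_sym.
by case: eqP; rewrite ?mulr1 ?mulr0.
Qed.

Lemma hsym_qser (C : fieldType) N d :
  hsym C N (Posz d) = qser 1 (\prod_(i < N) (1 - ('X_i)%:P * 'X)) d.
Proof.
rewrite qser_prod_linear.
(* Monomials of degree d are the exponent functions of sum d. *)
pose toM (f : {ffun 'I_N -> 'I_d.+1}) : 'X_{1..N < d.+1} :=
  insubd bm0 [multinom (f i : nat) | i < N].
pose ofM (m : 'X_{1..N < d.+1}) : {ffun 'I_N -> 'I_d.+1} :=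
  [ffun i => inord (m i)].
have ofM_E m i : ofM m i = m i :> nat.
  rewrite ffunE inordK // (leq_trans _ (bmdeg m)) // ltnS mdegE.
  by rewrite (bigD1 i) //= leq_addr.
have toM_E (f : {ffun 'I_N -> 'I_d.+1}) : (\sum_i f i)%N == d ->
    toM f = [multinom (f i : nat) | i < N] :> 'X_{1..N}.
  move=> /eqP sf; rewrite /toM /insubd insubT ?mdegE //=.
  by under eq_bigr do rewrite mnmE; rewrite sf.
rewrite /hsym (reindex_onto ofM toM) /=.
  apply: eq_big => [m|m /eqP dm].
    have sE : (\sum_i ofM m i)%N = mdeg m by rewrite mdegE; apply: eq_bigr.
    rewrite sE; case: (mdeg m =P d) => //= dm; apply/esym/eqP/val_inj.
    rewrite /= toM_E.
      by apply/mnmP => i; rewrite mnmE ofM_E.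
    by rewrite sE dm.
  by rewrite mpolyXE_id; apply: eq_bigr => i _; rewrite ofM_E.
move=> f sf; apply/ffunP => i; apply/val_inj.
by rewrite -[LHS]/(ofM (toM f) i : nat) ofM_E toM_E // mnmE.
Qed.

(** * Determinants *)

(** A determinant that is unitriangular below row l reduces to its upper left
    corner: this makes Jacobi-Trudi determinants insensitive to trailing zeros of
    the partition. *)
Lemma det_unitri_corner (A : comNzRingType) (B : nat -> nat -> A) l n :
    (l <= n)%N ->
    (forall j k, (l <= j)%N -> (k < j)%N -> B j k = 0) ->
    (forall j, (l <= j)%N -> B j j = 1) ->
  \det (\matrix_(j < n, k < n) B j k) = \det (\matrix_(j < l, k < l) B j k).
Proof.
move=> /subnK <- B0 B1; elim: (n - l)%N => // d IHd.
rewrite addSn (expand_det_row _ ord_max) (bigD1 ord_max) //= big1 => [|k nk].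
  rewrite addr0 !mxE /= B1 ?leq_addl // mul1r /cofactor addnn -signr_odd.
  rewrite odd_double mul1r -IHd; congr (\det _); apply/matrixP => j k.
  by rewrite !mxE !lift_max.
rewrite !mxE /= B0 ?mul0r ?leq_addl //.
by rewrite ltn_neqAle -ltnS ltn_ord andbT -(inj_eq val_inj) in nk *.
Qed.

Lemma det_rev (A : comNzRingType) n (B : 'M[A]_n) :
  \det (\matrix_(j, k) B (rev_ord j) (rev_ord k)) = \det B.
Proof.
pose s := perm (@rev_ord_inj n).
have -> : \matrix_(j, k) B (rev_ord j) (rev_ord k) = row_perm s (col_perm s B).
  by apply/matrixP => j k; rewrite !mxE !permE.
rewrite row_permE col_permE !det_mulmx !det_perm odd_permV mulrCA.
by rewrite -signr_addb addbb mulr1.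
Qed.

(** Hypothesis on p: p_m is monic of degree m.  The coefficients of such a family
    form a unitriangular matrix, whose product with a Vandermonde matrix is the
    matrix of values.  [Vandermonde] has increasing exponents and its determinant
    has the factors a_k - a_j for j < k; reversing both rows and columns converts
    to the decreasing convention without a sign. *)
Lemma det_monic_Vandermonde (A : comNzRingType) n (p : nat -> {poly A})
    (a : 'I_n -> A) :
    (forall m, (size (p m - 'X^m)%R <= m)%N) ->
  \det (\matrix_(j < n, k < n) (p (n - j.+1)%N).[a k]) =
  \prod_(j < n) \prod_(k < n | (j < k)%N) (a j - a k).
Proof.
move=> monic_p; rewrite -det_rev.
have coefp m i : (m <= i)%N -> (p m)`_i = (i == m)%:R.
  move=> lemi; have := leq_trans (monic_p m) lemi.
  move=> /leq_sizeP/(_ _ (leqnn i))/eqP.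
  by rewrite coefB coefXn subr_eq0 => /eqP.
pose L : 'M[A]_n := \matrix_(j, i) (p j)`_i.
pose a' : 'rV[A]_n := \row_k a (rev_ord k).
have -> : \matrix_(j, k) (\matrix_(j < n, k < n) (p (n - j.+1)%N).[a k])
            (rev_ord j) (rev_ord k) = L *m Vandermonde n a'.
  apply/matrixP => j k; rewrite !mxE /= subnSK // subKn 1?ltnW //.
  rewrite (@horner_coef_wide _ n).
    by apply: eq_bigr => i _; rewrite !mxE.
  apply/leq_sizeP => i leni; have ltji := leq_trans (ltn_ord j) leni.
  by rewrite coefp ?gtn_eqF // ltnW.
rewrite det_mulmx det_trig; last first.
  by apply/is_trig_mxP => i j ltij; rewrite mxE coefp ?gtn_eqF // ltnW.
rewrite big1 => [|i _]; last by rewrite mxE coefp ?eqxx.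
rewrite mul1r det_Vandermonde (exchange_big_dep xpredT) //=.
rewrite (reindex_inj rev_ord_inj); apply: eq_bigr => j _ /=.
rewrite (reindex_inj rev_ord_inj); apply: eq_big => [k|k _] /=.
  by have := ltn_ord j; have := ltn_ord k; lia.
by rewrite !mxE !rev_ordK.
Qed.

(** The Jacobi-Trudi entries of sp_la and o_la, for an arbitrary sequence h in
    place of the complete homogeneous functions; j and k start from 0. *)
Definition spJT (A : nmodType) (h : int -> A) (la : seq nat) (j k : nat) : A :=
  h ((nth 0%N la j)%:Z - j.+1%:Z + k.+1%:Z)
  + h ((nth 0%N la j)%:Z - j.+1%:Z - k.+1%:Z + 2%:Z).

Definition oJT (A : zmodType) (h : int -> A) (la : seq nat) (j k : nat) : A :=
  h ((nth 0%N la j)%:Z - j.+1%:Z + k.+1%:Z)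
  - h ((nth 0%N la j)%:Z - j.+1%:Z - k.+1%:Z).

Section Corners.

Variables (A : comNzRingType) (h : int -> A).
Hypotheses (hneg : forall k : int, (k < 0)%R -> h k = 0) (h0 : h 0 = 1).

Lemma det_oJT_widen la l n : (size la <= l <= n)%N ->
  \det (\matrix_(j < n, k < n) oJT h la j k) =
  \det (\matrix_(j < l, k < l) oJT h la j k).
Proof.
move=> /andP[lel len]; apply: det_unitri_corner => // [j k lej ltkj|j lej].
  rewrite /oJT nth_default ?(leq_trans lel) // !hneg ?subr0 //; lia.
rewrite /oJT nth_default ?(leq_trans lel) //.
rewrite (hneg (k := _ - _)) ?subr0; last lia.
by have -> : 0%:Z - j.+1%:Z + j.+1%:Z = 0 by lia.
Qed.

Lemma det_spJT_widen la l n : (0 < l)%N -> (size la <= l <= n)%N ->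
  \det (\matrix_(j < n, k < n) spJT h la j k) =
  \det (\matrix_(j < l, k < l) spJT h la j k).
Proof.
move=> l_gt0 /andP[lel len].
apply: det_unitri_corner => // [j k lej ltkj|j lej].
  rewrite /spJT nth_default ?(leq_trans lel) // !hneg ?addr0 //; lia.
rewrite /spJT nth_default ?(leq_trans lel) //.
rewrite (hneg (k := _ + 2%:Z)) ?addr0; last lia.
by have -> : 0%:Z - j.+1%:Z + j.+1%:Z = 0 by lia.
Qed.

Lemma det_oJT0 n : \det (\matrix_(j < n, k < n) oJT h [::] j k) = 1.
Proof. by rewrite (det_oJT_widen (l := 0)) // det_mx00. Qed.

(** Row and column 0 meet in h_0 + h_0, whence the factor 2 that the
    normalization of sp_la removes. *)
Lemma det_spJT0 n : (0 < n)%N ->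
  \det (\matrix_(j < n, k < n) spJT h [::] j k) = 2.
Proof.
by move=> n_gt0; rewrite (det_spJT_widen (l := 1)) // det_mx11 mxE /spJT /= h0.
Qed.

End Corners.

(** * Palindromic polynomials *)

Section Palindromic.

Variable A : comNzRingType.
Implicit Types p q : {poly A}.

(** The sign s is 1 for palindromic and -1 for antipalindromic polynomials; d is
    the degree about which the coefficients are reflected. *)
Definition palindromic (s : A) d p : Prop :=
  (size p <= d.+1)%N /\ forall i j, (i + j)%N = d -> p`_i = s * p`_j.

(** Unlike the one-index convolution, this double sum is visibly symmetric under
    reflection of both indices. *)
Lemma coefM_double p q d e i : (size p <= d.+1)%N -> (size q <= e.+1)%N ->
  (p * q)`_i =
  \sum_(u < d.+1) \sum_(v < e.+1) if (u + v)%N == i then p`_u * q`_v else 0.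
Proof.
have expand (r : {poly A}) f : (size r <= f.+1)%N ->
    r = \sum_(u < f.+1) r`_u *: 'X^u.
  move=> ler; rewrite -poly_def; apply/polyP => k; rewrite coef_poly.
  by case: ltnP => // ltfk; rewrite nth_default // (leq_trans ler).
move=> lep leq; rewrite {1}(expand p d) // {1}(expand q e) // mulr_suml coef_sum.
apply: eq_bigr => u _; rewrite mulr_sumr coef_sum; apply: eq_bigr => v _.
rewrite -scalerAl -scalerAr scalerA -exprD coefZ coefXn eq_sym.
by case: eqP; rewrite ?mulr1 ?mulr0.
Qed.

Lemma palindromicM s t d e p q :
  palindromic s d p -> palindromic t e q -> palindromic (s * t) (d + e) (p * q).
Proof.
move=> [lep symp] [leq symq]; split=> [|i j ijde].
  apply: leq_trans (size_polyMleq p q) _; lia.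
rewrite !(coefM_double _ lep leq) (reindex_inj rev_ord_inj) mulr_sumr /=.
apply: eq_bigr => u _; rewrite (reindex_inj rev_ord_inj) mulr_sumr /=.
apply: eq_bigr => v _; have := ltn_ord u; have := ltn_ord v => ltv ltu.
have -> : ((d.+1 - u.+1 + (e.+1 - v.+1))%N == i) = ((u + v)%N == j) by lia.
case: eqP => [_|]; last by rewrite mulr0.
have -> : p`_(d.+1 - u.+1) = s * p`_u by apply: symp; lia.
have -> : q`_(e.+1 - v.+1) = t * q`_v by apply: symq; lia.
by rewrite mulrACA.
Qed.

Lemma palindromic1 : palindromic 1 0 1.
Proof.
split=> [|i j]; first by rewrite size_poly1.
by move/eqP; rewrite addn_eq0 => /andP[/eqP-> /eqP->]; rewrite mul1r.
Qed.

(** As [quad (x + 1/x)] is (1 - x t)(1 - t/x), a pair of letters x, 1/x enters the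
    generating functions only through x + 1/x. *)
Definition quad (a : A) : {poly A} := 1 - a%:P * 'X + 'X^2.

(** The factor of the generating function of the h_k contributed by the extra
    letter 1 of an odd alphabet. *)
Definition odd_factor (b : bool) : {poly A} := if b then 1 - 'X else 1.

Lemma coef_quad a i :
  (quad a)`_i = if i == 0%N then 1 else if i == 1%N then - a
                else if i == 2%N then 1 else 0.
Proof.
rewrite /quad coefD coefB coefCM coef1 coefX coefXn.
by case: i => [|[|[|i]]] /=; ring.
Qed.

Lemma palindromic_quad a : palindromic 1 2 (quad a).
Proof.
split=> [|i j ij]; first by apply/leq_sizeP => -[|[|[|i]]] // _; rewrite coef_quad.
by case: i j ij => [|[|[|i]]] [|[|[|j]]] //= _; rewrite !coef_quad mul1r.
Qed.

Lemma coef_1mX2 i :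
  (1 - 'X^2 : {poly A})`_i = if i == 0%N then 1 else if i == 2%N then -1 else 0.
Proof. by rewrite coefB coef1 coefXn; case: i => [|[|[|i]]] /=; ring. Qed.

Lemma palindromic_1mX2 : palindromic (-1) 2 (1 - 'X^2 : {poly A}).
Proof.
split=> [|i j ij].
  by apply/leq_sizeP => -[|[|[|i]]] // _; rewrite coef_1mX2.
by case: i j ij => [|[|[|i]]] [|[|[|j]]] //= _; rewrite !coef_1mX2 /=; ring.
Qed.

Lemma palindromic_prod_quad (I : finType) (P : pred I) (a : I -> A) :
  palindromic 1 (#|P| * 2) (\prod_(i in P) quad (a i)).
Proof.
rewrite -sum_nat_const.
apply: (big_rec2 (fun d p => palindromic 1 d p)) => [|i d p _ palp].
  exact: palindromic1.
by rewrite -(mulr1 1); apply: palindromicM => //; apply: palindromic_quad.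
Qed.

End Palindromic.

(** * Bialternant formulas from palindromic coefficients *)

Lemma sum_fold (A : nmodType) (f : nat -> A) p :
  \sum_(i < (p * 2).+1) f i =
  f p + \sum_(k < p) (f (p - k.+1)%N + f (p + k.+1)%N).
Proof.
have -> : (p * 2).+1 = (p + p.+1)%N by lia.
rewrite big_split_ord /= big_ord_recl /= addn0 addrCA big_split /=.
by congr (_ + (_ + _)); rewrite (reindex_inj rev_ord_inj).
Qed.

Section Bialternant.

Variables (F : fieldType) (h : int -> F).
Hypothesis two_neq0 : (2 : F) != 0.

(** The sequence x(., r) is the product of the polynomial c_r with the series h.
    By symmetry of c_r the terms at equal distance from the middle one combine to
    an entry of the Jacobi-Trudi matrix of la times a coefficient of c_r that does
    not depend on la; D is the determinant of these coefficients. *)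
Lemma det_bialternant_sp n (c : 'I_n -> {poly F}) (x : nat -> 'I_n -> F) :
    (0 < n)%N ->
    (forall r, palindromic 1 (n.-1 * 2) (c r)) ->
    (forall m r, x m r =
       \sum_(i < (n.-1 * 2).+1) (c r)`_i * h (m%:Z - i%:Z)) ->
  exists D : F, forall la,
    \det (\matrix_(j < n, k < n) x (nth 0 la j + n - j.+1)%N k) =
    \det (\matrix_(j < n, k < n) spJT h la j k) * D.
Proof.
move=> n_gt0 palc xE.
(* Column 0 of the Jacobi-Trudi matrix counts the middle term twice. *)
pose B : 'M[F]_n := \matrix_(k, r)
  if (k == 0 :> nat)%N then 2^-1 * (c r)`_n.-1 else (c r)`_(n.-1 - k).
exists (\det B) => la; rewrite -det_mulmx; congr (\det _).
apply/matrixP => j r; rewrite !mxE xE.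
rewrite (sum_fold (fun i => (c r)`_i * h (_%:Z - i%:Z))).
case: n => // p in c x j r palc xE n_gt0 B *.
rewrite big_ord_recl /=; congr (_ + _).
  rewrite !mxE /spJT /=; set y := h _; set y1 := h _; set y2 := h _.
  have -> : y1 = y by congr (h _); have := ltn_ord j; lia.
  have -> : y2 = y by congr (h _); have := ltn_ord j; lia.
  by field.
apply: eq_bigr => k _; rewrite !mxE /spJT /=.
have [_ /(_ (p + k.+1)%N (p - k.+1)%N) ->] := palc r; last by have := ltn_ord k; lia.
rewrite mul1r mulrC [X in _ + X]mulrC -mulrDl /bump /= add1n; congr ((h _ + h _) * _).
- by have := ltn_ord j; have := ltn_ord k; lia.
- by have := ltn_ord j; have := ltn_ord k; lia.
Qed.

(** Here the middle coefficient of c_r vanishes by antisymmetry, and n pairs of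
    terms remain. *)
Lemma det_bialternant_o n (c : 'I_n -> {poly F}) (x : nat -> 'I_n -> F) :
    (forall r, palindromic (-1) (n * 2) (c r)) ->
    (forall m r, x m r = \sum_(i < (n * 2).+1) (c r)`_i * h (m%:Z - i%:Z)) ->
  exists D : F, forall la,
    \det (\matrix_(j < n, k < n) x (nth 0 la j + n - j.+1)%N k) =
    \det (\matrix_(j < n, k < n) oJT h la j k) * D.
Proof.
move=> palc xE.
pose B : 'M[F]_n := \matrix_(k, r) (c r)`_(n - k.+1).
exists (\det B) => la; rewrite -det_mulmx; congr (\det _).
apply/matrixP => j r; rewrite !mxE xE.
rewrite (sum_fold (fun i => (c r)`_i * h (_%:Z - i%:Z))).
have mid0 : (c r)`_n = 0.
  have [_ /(_ n n)] := palc r; rewrite muln2 addnn => /(_ erefl) /eqP.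
  rewrite mulN1r -addr_eq0 -mulr2n -mulr_natl mulf_eq0 (negPf two_neq0).
  by move=> /eqP.
rewrite mid0 mul0r add0r; apply: eq_bigr => k _; rewrite !mxE /oJT.
have [_ /(_ (n + k.+1)%N (n - k.+1)%N) ->] := palc r; last by have := ltn_ord k; lia.
rewrite mulN1r mulNr mulrC [X in _ - X]mulrC -mulrBl; congr ((h _ - h _) * _).
- by have := ltn_ord j; have := ltn_ord k; lia.
- by have := ltn_ord j; have := ltn_ord k; lia.
Qed.

End Bialternant.

(** * Generating functions of the Chebyshev polynomials *)

Section ChebyshevSeries.

Variable K : fieldType.
Hypothesis two_neq0 : (2 : K) != 0.
Implicit Types a : K.

(** Multiplying by 1 - a t + t^2 turns the Chebyshev recurrence into initial
    conditions and a possible perturbation, which are the coefficients of P. *)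
Lemma qser_quad (P : {poly K}) a (g : nat -> K) :
    g 0%N = P`_0 -> g 1%N = a * g 0%N + P`_1 ->
    (forall m, g m.+2 = a * g m.+1 - g m + P`_m.+2) ->
  forall m, g m = qser P (quad a) m.
Proof.
move=> g0 g1 gS m; pose G := \poly_(i < m.+1) g i.
have -> : g m = G`_m by rewrite coef_poly ltnSn.
apply/esym/qser_unique => [|k lekm]; first by rewrite coef_quad.
rewrite mulrC /quad mulrDr mulrBr mulr1 mulrCA coefD coefB coefCM coefMX coefMXn.
case: k => [|[|k]] in lekm *; rewrite !coef_poly ?ltnS ?lekm /=.
- by rewrite g0; ring.
- by rewrite g1; ring.
- by rewrite subn2 /= (ltnW lekm) (ltnW (ltnW lekm)) gS; ring.
Qed.

(** The substitution of u/2 for u, which makes the Chebyshev polynomials monic. *)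
Definition cheb_half (p : {poly K}) : {poly K} := p \Po (2^-1 *: 'X).

Lemma cheb_half_rec p1 m :
  cheb_half (cheb p1 m.+2) =
  'X * cheb_half (cheb p1 m.+1) - cheb_half (cheb p1 m).
Proof.
rewrite /cheb_half /= comp_polyB comp_polyM comp_polyZ comp_polyX.
by rewrite scalerA divff // scale1r.
Qed.

Lemma half_2X : cheb_half (2 *: 'X) = 'X.
Proof. by rewrite /cheb_half comp_polyZ comp_polyX scalerA divff // scale1r. Qed.

Lemma horner_half p a : p.[a / 2] = (cheb_half p).[a].
Proof. by rewrite horner_comp !hornerE mulrC. Qed.

(** The recurrence of 2 T_m(u/2) starts from 2, that of Tmonic_m from 1; the last
    term accounts for this. *)
Lemma chebTmonic_rec m :
  chebTmonic m.+2 = 'X * chebTmonic m.+1 - chebTmonic m - (m == 0%N)%:R :> {poly K}.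
Proof.
rewrite /chebTmonic /= -/(cheb_half _) -/(cheb_half _) cheb_half_rec.
rewrite scalerBr scalerAr; case: m => [|m] /=; last by rewrite subr0.
by rewrite [cheb_half 1]comp_polyC (scaler_nat 2 1%:P) mulr2n opprD addrA.
Qed.

Lemma chebU1S m : chebU1 m.+1 = chebU1 m + chebU m.+1 :> {poly K}.
Proof. by rewrite /chebU1 big_nat_recr. Qed.

Lemma cheb_half_U1_rec m :
  cheb_half (chebU1 m.+2) =
  'X * cheb_half (chebU1 m.+1) - cheb_half (chebU1 m) + 1.
Proof.
have half_U1S k : cheb_half (chebU1 k.+1) =
  cheb_half (chebU1 k) + cheb_half (chebU k.+1).
  by rewrite chebU1S; apply: comp_polyD.
have recU k : cheb_half (chebU k.+2) =
  'X * cheb_half (chebU k.+1) - cheb_half (chebU k) by apply: cheb_half_rec.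
elim: m => [|m IHm].
  have e0 : chebU1 0 = chebU 0 :> {poly K} by rewrite /chebU1 big_nat1.
  rewrite !half_U1S e0 recU.
  have -> : cheb_half (chebU 0) = 1 by apply: comp_polyC.
  have -> : cheb_half (chebU 1) = 'X by apply: half_2X.
  by ring.
by rewrite half_U1S {1}IHm recU !half_U1S; ring.
Qed.

Lemma chebU_qser m a :
  (chebU m).[a / 2] = qser 1 (odd_factor K false * quad a) m.
Proof.
rewrite mul1r; apply: (qser_quad (g := fun m => (chebU m).[a / 2])) => [||k].
- by rewrite /= hornerC coef1.
- by rewrite /= hornerZ hornerX hornerC coef1 mulrC divfK // mulr1 addr0.
- by rewrite !horner_half cheb_half_rec coef1 addr0 hornerD hornerN hornerM hornerX.
Qed.

Lemma chebTmonic_qser m a : (chebTmonic m).[a] =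
  qser (1 - 'X^2) (odd_factor K false * quad a) m.
Proof.
rewrite mul1r; apply: (qser_quad (g := fun m => (chebTmonic m).[a])) => [||k].
- by rewrite /chebTmonic coef_1mX2 /= hornerC.
- rewrite /chebTmonic coef_1mX2 /= comp_polyX scalerA divff // scale1r.
  by rewrite hornerX hornerC mulr1 addr0.
- rewrite chebTmonic_rec coef_1mX2 hornerD hornerN hornerD hornerN hornerM hornerX.
  by case: k => [|k] /=; rewrite ?hornerC ?horner0 ?subr0 ?addr0.
Qed.

(** Dividing by 1 - t takes partial sums: the two sides have the same
    differences, by [step], and the same value at 0. *)
Lemma chebU1_qser m a : (chebU1 m).[a / 2] = qser 1 (odd_factor K true * quad a) m.
Proof.
rewrite /odd_factor.
have X0 : (1 - 'X : {poly K})`_0 = 1 by rewrite coefB coef1 coefX subr0.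
have E0 : ((1 - 'X) * quad a)`_0 = 1 by rewrite coefM big_ord1 X0 coef_quad mulr1.
have step k : qser 1 (quad a) k.+1 =
    qser 1 ((1 - 'X) * quad a) k.+1 - qser 1 ((1 - 'X) * quad a) k.
  rewrite -(qser_cancel 1 k.+1 (_ : (quad a)`_0 = 1) X0) ?coef_quad //.
  rewrite [quad a * _]mulrC [1 * (1 - 'X)]mulrC qser_conv //.
  rewrite 2!big_ord_recl big1 => [|i _]; last first.
    by rewrite coefB coef1 coefX /= subr0 mul0r.
  by rewrite !coefB !coef1 !coefX /= subr0 sub0r mul1r mulN1r addr0 subSS !subn0.
elim: m => [|m IHm].
  rewrite /chebU1 big_nat1 /= hornerC /qser big_ord1 mulr1 coef1 //.
by rewrite chebU1S hornerD IHm chebU_qser mul1r step addrC subrK.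
Qed.

(** The generating function (1 + t) / (1 - a t + t^2) is brought to the common
    denominator of the odd alphabet by the factor 1 - t. *)
Lemma chebW_qser m a :
  (chebW m).[a / 2] = qser (1 - 'X^2) (odd_factor K true * quad a) m.
Proof.
rewrite /odd_factor.
have X0 : (1 - 'X : {poly K})`_0 = 1 by rewrite coefB coef1 coefX subr0.
have -> : 1 - 'X^2 = (1 + 'X) * (1 - 'X) :> {poly K} by ring.
rewrite [(1 - 'X) * quad a]mulrC qser_cancel ?coef_quad //.
apply: (qser_quad (g := fun m => (chebW m).[a / 2])) => [||k].
- by rewrite /= hornerC coefD coef1 coefX addr0.
- rewrite /= hornerD hornerZ hornerX hornerC coefD coef1 coefX mulrC divfK //.
  by rewrite mulr1 add0r.
- rewrite !horner_half cheb_half_rec coefD coef1 coefX !addr0.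
  by rewrite hornerD hornerN hornerM hornerX.
Qed.

Lemma chebW_opp m b : (chebW m).[- b] = (-1) ^+ m * (chebV m).[b] :> K.
Proof.
suff [] : (chebW m).[- b] = (-1) ^+ m * (chebV m).[b] /\
          (chebW m.+1).[- b] = (-1) ^+ m.+1 * (chebV m.+1).[b] by [].
elim: m => [|m [IH IHS]]; first by split; rewrite /= !hornerE; ring.
split=> //; rewrite /chebW /chebV /= -/(chebW _) -/(chebW _) -/(chebV _).
rewrite !(hornerD, hornerN, hornerM, hornerZ, hornerX) IH IHS !exprS.
by ring.
Qed.

(** The recurrence is allowed a constant error, which occurs for Tmonic and U1. *)
Lemma size_sub_Xn_rec (r : nat -> {poly K}) :
    (size (r 0%N - 1)%R <= 0)%N -> (size (r 1%N - 'X)%R <= 1)%N ->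
    (forall m, (size (r m.+2 - ('X * r m.+1 - r m))%R <= 1)%N) ->
  forall m, (size (r m - 'X^m)%R <= m)%N.
Proof.
move=> r0 r1 rS m.
suff [] : (size (r m - 'X^m)%R <= m)%N /\
    (size (r m.+1 - 'X^(m.+1))%R <= m.+1)%N by [].
elim: m => [|m [IH IHS]]; first by split; rewrite ?expr0 ?expr1.
split=> //.
have -> : r m.+2 - 'X^(m.+2) = (r m.+2 - ('X * r m.+1 - r m))
    + ((r m.+1 - 'X^(m.+1)) * 'X - (r m - 'X^m + 'X^m)).
  by rewrite !exprS; ring.
have leD (p q : {poly K}) d :
    (size p <= d)%N -> (size q <= d)%N -> (size (p + q)%R <= d)%N.
  by move=> lep leq; rewrite (leq_trans (size_polyD _ _)) // geq_max lep.
apply: (leD); first exact: leq_trans (rS m) _.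
apply: (leD); first by rewrite (leq_trans (size_polyMleq _ _)) // size_polyX addn2.
rewrite size_polyN; apply: (leD); first by rewrite (leq_trans IH) ?leqW.
by rewrite size_polyXn.
Qed.

Lemma size_cheb_half p1 : (size (cheb_half p1 - 'X)%R <= 1)%N ->
  forall m, (size (cheb_half (cheb p1 m) - 'X^m)%R <= m)%N.
Proof.
move=> lep; apply: size_sub_Xn_rec => [||m] //=.
- by rewrite /cheb_half comp_polyC subrr size_poly0.
- by rewrite cheb_half_rec subrr size_poly0.
Qed.

Lemma monic_chebU m : (size (cheb_half (chebU m) - 'X^m)%R <= m)%N.
Proof.
apply: size_cheb_half => //.
by rewrite half_2X subrr size_poly0.
Qed.

Lemma monic_chebV m : (size (cheb_half (chebV m) - 'X^m)%R <= m)%N.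
Proof.
apply: size_cheb_half => //.
rewrite /cheb_half comp_polyB comp_polyC comp_polyZ comp_polyX scalerA divff // scale1r.
by rewrite addrAC subrr sub0r size_polyN size_poly1.
Qed.

Lemma monic_chebW m : (size (cheb_half (chebW m) - 'X^m)%R <= m)%N.
Proof.
apply: size_cheb_half => //.
rewrite /cheb_half comp_polyD comp_polyC comp_polyZ comp_polyX scalerA divff // scale1r.
by rewrite addrAC subrr add0r size_poly1.
Qed.

Lemma monic_chebTmonic m : (size (chebTmonic m - 'X^m : {poly K})%R <= m)%N.
Proof.
apply: size_sub_Xn_rec => [||k].
- by rewrite subrr size_poly0.
- rewrite /chebTmonic /= comp_polyX scalerA divff // scale1r subrr.
  by rewrite size_poly0.
- rewrite chebTmonic_rec // addrAC subrr sub0r size_polyN -polyC_natr.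
  exact: size_polyC_leq1.
Qed.

Lemma monic_chebU1 m : (size (cheb_half (chebU1 m) - 'X^m)%R <= m)%N.
Proof.
have half1 : cheb_half (1 : {poly K}) = 1 by apply: comp_polyC.
have U10 : chebU1 0 = 1 :> {poly K} by rewrite /chebU1 big_nat1.
apply: (size_sub_Xn_rec (r := fun m => cheb_half (chebU1 m))) => [||k].
- by rewrite U10 half1 subrr size_poly0.
- rewrite chebU1S U10 /cheb_half comp_polyD comp_polyC comp_polyZ comp_polyX.
  by rewrite scalerA divff // scale1r addrK size_poly1.
- by rewrite cheb_half_U1_rec // addrAC subrr add0r size_poly1.
Qed.

End ChebyshevSeries.

(** * The series of the symplectic and orthogonal alphabets *)

Section Denominator.

Variable A : comNzRingType.

(** The h_k whose generating function is 1 / E, with h_k = 0 for negative k. *)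
Definition hser (E : {poly A}) (k : int) : A :=
  match k with Posz d => qser 1 E d | Negz _ => 0 end.

Lemma hser_neg E (k : int) : (k < 0)%R -> hser E k = 0.
Proof. by case: k. Qed.

Lemma hser0 E : hser E 0 = 1.
Proof. by rewrite /= /qser big_ord1 expr0 mulr1 coef1. Qed.

(** With negative indices allowed in h, the convolution extends over all the
    coefficients of P at once, as folding about the middle term requires. *)
Lemma qser_int (P E : {poly A}) N m : E`_0 = 1 -> (size P <= N)%N ->
  qser P E m = \sum_(i < N) P`_i * hser E (m%:Z - i%:Z).
Proof.
move=> E0 leP.
have trunc (f : nat -> A) a b : (a <= b)%N ->
    (forall i, (a <= i)%N -> f i = 0) -> \sum_(i < a) f i = \sum_(i < b) f i.
  move=> /subnKC <- f0; rewrite big_split_ord /= [X in _ + X]big1 ?addr0 // => i _.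
  by rewrite f0 ?leq_addr.
pose f i := P`_i * hser E (m%:Z - i%:Z).
transitivity (\sum_(i < N + m.+1) f i); last first.
  apply/esym/(trunc f); first exact: leq_addr.
  by move=> i leNi; rewrite /f nth_default ?mul0r // (leq_trans leP).
transitivity (\sum_(i < m.+1) f i); last first.
  apply: (trunc f); first exact: leq_addl.
  by move=> i ltmi; rewrite /f hser_neg ?mulr0 //; lia.
rewrite -[P in LHS]mulr1 qser_conv //; apply: eq_bigr => i _; rewrite /f.
have lei : (i <= m)%N by rewrite -ltnS.
by rewrite subzn.
Qed.

(** The denominator of the generating function of the h_k in the letters x_i,
    1 / x_i (and 1, if b holds), where a_i = x_i + 1 / x_i. *)
Definition zden (I : finType) b (a : I -> A) : {poly A} :=
  odd_factor A b * \prod_i quad (a i).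

Lemma odd_factor0 b : (odd_factor A b)`_0 = 1.
Proof. by case: b; rewrite ?coefB coef1 // coefX subr0. Qed.

Lemma coef0M1 (p q : {poly A}) : p`_0 = 1 -> q`_0 = 1 -> (p * q)`_0 = 1.
Proof. by move=> p0 q0; rewrite coefM big_ord1 p0 q0 mulr1. Qed.

Lemma prod_quad0 (I : finType) (Q : pred I) (a : I -> A) :
  (\prod_(i | Q i) quad (a i))`_0 = 1.
Proof. by rewrite coef0_prod big1 // => i _; rewrite coef_quad. Qed.

(** All the Chebyshev series, whatever the point a_r, are brought to the common
    denominator [zden b a]; the missing factors go to the numerator. *)
Lemma qser_zden n (a : 'I_n -> A) b (p : {poly A}) m (r : 'I_n) :
  qser p (odd_factor A b * quad (a r)) m =
  qser (p * \prod_(i in predC1 r) quad (a i)) (zden b a) m.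
Proof.
have -> : zden b a = odd_factor A b * quad (a r) * \prod_(i in predC1 r) quad (a i).
  by rewrite /zden (bigD1 r) //= mulrA.
by rewrite qser_cancel // ?prod_quad0 // coef0M1 ?odd_factor0 ?coef_quad.
Qed.

Lemma eq_zden (I : finType) b (a a' : I -> A) : a =1 a' -> zden b a = zden b a'.
Proof. by move=> eqa; congr (_ * _); apply: eq_bigr => i _; rewrite eqa. Qed.

Lemma zden_perm (I : finType) b (a : I -> A) (s : {perm I}) :
  zden b (a \o s) = zden b a.
Proof. by congr (_ * _); rewrite [RHS](reindex_inj (@perm_inj _ s)). Qed.

End Denominator.

Lemma prod_reciprocal_alphabet (F : fieldType) n (x : 'I_n -> F) al :
    (forall i, x i != 0) ->
    (forall i, al (lshift n i) = x i) -> (forall i, al (rshift n i) = (x i)^-1) ->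
  \prod_(i < n + n) (1 - (al i)%:P * 'X) = zden false (fun i => x i + (x i)^-1).
Proof.
move=> x_neq0 all alr; rewrite big_split_ord /= /zden mul1r -big_split.
apply: eq_bigr => i _ /=; rewrite all alr.
have xV : (x i)%:P * (x i)^-1%:P = 1 by rewrite -polyCM divff ?x_neq0.
rewrite /quad polyCD; set y := (x i)^-1%:P in xV *.
by have -> : 'X^2 = (x i)%:P * y * 'X^2 by [rewrite xV mul1r]; ring.
Qed.

Lemma prod_reciprocal_alphabet1 (F : fieldType) n (x : 'I_n -> F) al al' :
    (forall i, x i != 0) ->
    (forall i, al (lshift n i) = x i) -> (forall i, al (rshift n i) = (x i)^-1) ->
    (forall i, al' (lshift 1 i) = al i) -> (forall i, al' (rshift _ i) = 1) ->
  \prod_(i < n + n + 1) (1 - (al' i)%:P * 'X) =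
  zden true (fun i => x i + (x i)^-1).
Proof.
move=> x_neq0 all alr al'l al'r; rewrite big_split_ord /= big_ord1 al'r mul1r.
have -> : zden true (fun i => x i + (x i)^-1) =
    zden false (fun i => x i + (x i)^-1) * (1 - 'X).
  by rewrite /zden /odd_factor mul1r mulrC.
rewrite -(prod_reciprocal_alphabet x_neq0 all alr); congr (_ * _).
by apply: eq_bigr => i _; rewrite al'l.
Qed.

Section Morphisms.

Variables (A B : comNzRingType) (f : {rmorphism A -> B}).

Lemma map_quad a : map_poly f (quad a) = quad (f a).
Proof.
by rewrite /quad rmorphD rmorphB rmorphM rmorph1 /= map_polyC map_polyX map_polyXn.
Qed.

Lemma map_zden (I : finType) b (a : I -> A) :
  map_poly f (zden b a) = zden b (f \o a).
Proof.
rewrite /zden rmorphM rmorph_prod; congr (_ * _).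
  by case: b; rewrite /= ?rmorphB ?rmorph1 //= map_polyX.
by apply: eq_bigr => i _; apply: map_quad.
Qed.

Lemma rmorph_hser E k : f (hser E k) = hser (map_poly f E) k.
Proof. by case: k => d; rewrite /= ?rmorph0 // rmorph_qser rmorph1. Qed.

Lemma rmorph_det_spJT h h' la m : (forall k, f (h k) = h' k) ->
  f (\det (\matrix_(j < m, k < m) spJT h la j k)) =
  \det (\matrix_(j < m, k < m) spJT h' la j k).
Proof.
move=> fh; rewrite -det_map_mx; congr (\det _); apply/matrixP => j k.
by rewrite !mxE rmorphD !fh.
Qed.

Lemma rmorph_det_oJT h h' la m : (forall k, f (h k) = h' k) ->
  f (\det (\matrix_(j < m, k < m) oJT h la j k)) =
  \det (\matrix_(j < m, k < m) oJT h' la j k).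
Proof.
move=> fh; rewrite -det_map_mx; congr (\det _); apply/matrixP => j k.
by rewrite !mxE rmorphB !fh.
Qed.

End Morphisms.

Section Ratios.

Variables (F : fieldType) (n : nat) (a : 'I_n -> F) (b : bool).
Hypothesis two_neq0 : (2 : F) != 0.

(** By the generating functions, the determinants of values of U, Tmonic, U1 and W
    are of this form, with p = 1 or 1 - t^2 and b false or true. *)
Definition serdet (p : {poly F}) (la : seq nat) : F :=
  \det (\matrix_(j < n, k < n)
    qser p (odd_factor F b * quad (a k)) (nth 0 la j + n - j.+1)%N).

Let h := hser (zden b a).

Let hneg (k : int) : (k < 0)%R -> h k = 0. Proof. exact: hser_neg. Qed.

Let h0 : h 0 = 1. Proof. exact: hser0. Qed.

Lemma zden0 : (zden b a)`_0 = 1.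
Proof. by rewrite coef0M1 ?odd_factor0 ?prod_quad0. Qed.

Lemma palindromic_minor r :
  palindromic 1 (n.-1 * 2) (\prod_(i in predC1 r) quad (a i)).
Proof.
by have := palindromic_prod_quad (predC1 r) a; rewrite cardC1 card_ord.
Qed.

Lemma sp_ratio la : (0 < n)%N -> (size la <= n)%N ->
  (if la is [::] then 1 else
     2^-1 * \det (\matrix_(j < size la, k < size la) spJT h la j k))
  * serdet 1 [::] = serdet 1 la.
Proof.
move=> n_gt0 len.
have [|D DE] := det_bialternant_sp (h := h) two_neq0 n_gt0 palindromic_minor
  (x := fun m r => qser 1 (odd_factor F b * quad (a r)) m).
  move=> m r; rewrite qser_zden mul1r; apply: qser_int zden0 _.
  by have [] := palindromic_minor r.
rewrite /serdet !DE (det_spJT0 hneg h0 n_gt0).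
case: la len => [|l la] len; first by rewrite mul1r (det_spJT0 hneg h0 n_gt0).
rewrite (det_spJT_widen hneg h0 (l := size (l :: la))) ?len ?leqnn //.
by field.
Qed.

Lemma o_ratio la : (size la <= n)%N ->
  \det (\matrix_(j < size la, k < size la) oJT h la j k)
  * serdet (1 - 'X^2) [::] = serdet (1 - 'X^2) la.
Proof.
move=> len.
have palc r : palindromic (-1) (n * 2)
    ((1 - 'X^2) * \prod_(i in predC1 r) quad (a i)).
  have -> : (n * 2 = 2 + n.-1 * 2)%N by have := ltn_ord r; lia.
  rewrite -[-1]mulr1; apply: palindromicM; last exact: palindromic_minor.
  exact: palindromic_1mX2.
have [|D DE] := det_bialternant_o (h := h) two_neq0 palc
  (x := fun m r => qser (1 - 'X^2) (odd_factor F b * quad (a r)) m).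
  move=> m r; rewrite qser_zden; apply: qser_int zden0 _.
  by have [] := palc r.
rewrite /serdet !DE (det_oJT0 hneg h0) mul1r.
by rewrite (det_oJT_widen hneg h0 (l := size la)) ?len ?leqnn.
Qed.

End Ratios.

(** * Algebraic independence of the x_i + 1 / x_i *)

Section AlgebraicIndependence.

Variables (C : fieldType) (n : nat).

Definition peval_rm N (a : 'I_N -> ratfun C n) :
    {rmorphism {mpoly C[N]} -> ratfun C n} :=
  mmap (@tofrac {mpoly C[n]} \o @mpolyC n C) a.

Lemma pevalE N (P : {mpoly C[N]}) a : peval P a = peval_rm a P.
Proof. by []. Qed.

Definition monic_at (p : {mpoly C[n]}) (m : 'X_{1..n}) : Prop :=
  mlead p = m /\ p@_m = 1.

Lemma monic_atM p q m k :
  monic_at p m -> monic_at q k -> monic_at (p * q) (m + k)%MM.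
Proof.
have nz r l : monic_at r l -> r != 0.
  move=> [_ rl]; apply/eqP => r0; move: rl.
  by rewrite r0 mcoeff0 => /eqP; rewrite eq_sym oner_eq0.
move=> hp hq; have [p0 q0] := (nz _ _ hp, nz _ _ hq).
case: hp hq => <- p1 [<- q1]; split; first by rewrite mleadM.
by rewrite mleadcM p1 q1 mulr1.
Qed.

Lemma monic_at1 : monic_at 1 0%MM.
Proof. by split; rewrite ?mlead1 // mcoeff1 eqxx. Qed.

Lemma monic_atXn p m k : monic_at p m -> monic_at (p ^+ k) (m *+ k)%MM.
Proof.
move=> hp; elim: k => [|k IHk]; first by rewrite expr0 mulm0n; exact: monic_at1.
by rewrite exprS mulmS; apply: monic_atM.
Qed.

Lemma monic_atX i : monic_at 'X_i U_(i)%MM.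
Proof. by split; rewrite ?mleadXm // mcoeffX eqxx. Qed.

Lemma monic_atX2D1 i : monic_at ('X_i ^+ 2 + 1) (U_(i) *+ 2)%MM.
Proof.
have [lX2 cX2] := monic_atXn 2 (monic_atX i).
have U2 : (U_(i) *+ 2)%MM != 0%MM by rewrite -mdeg_eq0 mdegMn mdeg1.
split; last by rewrite mcoeffD cX2 mcoeff1 (negPf U2) addr0.
rewrite mleadDl lX2 // mlead1 lt_mdeg_ltmc // mdeg0 mdegMn mdeg1 //.
Qed.

Lemma ratX_neq0 (i : 'I_n) : ratX C i != 0.
Proof.
rewrite tofrac_eq0; apply/eqP => /(congr1 (mcoeff U_(i))).
by rewrite mcoeffX eqxx mcoeff0 => /eqP; rewrite oner_eq0.
Qed.

(** Multiplied by the d-th power of the product of the x_i, the monomial m in the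
    x_i + 1 / x_i becomes the polynomial g m, with leading monomial m + D.
    Among the monomials m of Q only mlead Q reaches mlead Q + D, so the coefficient
    there of the corresponding combination of the g m is the leading coefficient
    of Q. *)
Lemma peval_zeta_inj :
  injective (fun Q : {mpoly C[n]} => peval Q (fun i => ratX C i + (ratX C i)^-1)).
Proof.
move=> Q1 Q2 /= /eqP; rewrite !pevalE -subr_eq0 -rmorphB => /eqP Q0.
apply/eqP; rewrite -subr_eq0; apply/negPn/negP => nzQ.
move: (Q1 - Q2) nzQ Q0 => Q nzQ {Q1 Q2} Q0.
pose d := msize Q.
pose g (m : 'X_{1..n}) : {mpoly C[n]} :=
  \prod_i ('X_i ^+ (d - m i) * ('X_i ^+ 2 + 1) ^+ m i).
pose D := (\sum_i (U_(i) *+ d))%MM : 'X_{1..n}.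
have led m i : m \in msupp Q -> (m i <= d)%N.
  move=> /msize_mdeg_lt ltm; apply: leq_trans (ltnW ltm).
  by rewrite mdegE (bigD1 i) //= leq_addr.
have monic_g m : m \in msupp Q -> monic_at (g m) (m + D)%MM.
  move=> mQ.
  have -> : (m + D)%MM =
      (\sum_i (U_(i) *+ (d - m i) + U_(i) *+ 2 *+ m i))%MM.
    rewrite [m in LHS]multinomUE_id -big_split /=; apply: eq_bigr => i _.
    apply/mnmP => j; rewrite !(mnmDE, mulmnE); have := led m i mQ.
    by case: (U_(i)%MM j) => //; nia.
  apply: (big_ind2 monic_at) => [|p k q l|i _].
  - exact: monic_at1.
  - exact: monic_atM.
  by apply: monic_atM; apply: monic_atXn; [exact: monic_atX|exact: monic_atX2D1].
have sum0 : \sum_(m <- msupp Q) Q@_m *: g m = 0.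
  apply/eqP; rewrite -tofrac_eq0 rmorph_sum /=; apply/eqP.
  transitivity ((\prod_i ratX C i) ^+ d *
      peval_rm (fun i => ratX C i + (ratX C i)^-1) Q).
    rewrite /peval_rm /= /mmap mulr_sumr; apply: eq_big_seq => m mQ.
    rewrite -mul_mpolyC rmorphM mulrCA; congr (_ * _).
    rewrite /mmap1 -prodrXl -big_split rmorph_prod; apply: eq_bigr => i _ /=.
    rewrite rmorphM !rmorphXn rmorphD rmorphXn rmorph1 -/(ratX C i).
    rewrite -[in RHS](subnK (led m i mQ)) exprD -mulrA -exprMn.
    by rewrite mulrDr divff ?ratX_neq0.
  by rewrite Q0 mulr0.
have /(congr1 (mcoeff (mlead Q + D)))/eqP := sum0.
rewrite raddf_sum mcoeff0 (bigD1_seq (mlead Q)) ?msupp_uniq ?mlead_supp //=.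
rewrite big_seq_cond big1 => [|m /andP[mQ ne_m]].
  rewrite addr0 mcoeffZ; have [_ ->] := monic_g _ (mlead_supp nzQ).
  by rewrite mulr1 mleadc_eq0 (negPf nzQ).
rewrite mcoeffZ [(g m)@__]mcoeff_gt_mlead ?mulr0 //.
have [-> _] := monic_g _ mQ; rewrite ltmc_add2l.
by rewrite Order.POrderTheory.lt_neqAle ne_m msupp_le_mlead.
Qed.

(** Injectivity makes the polynomial chosen by epsilon equal to any other one with
    the defining property. *)
Lemma PhiE (P : {mpoly C[n + n]}) Q : Q \is symmetric ->
    peval P (@alphabet C n) = peval Q (fun i => ratX C i + (ratX C i)^-1) ->
  Phi P = Q.
Proof.
move=> symQ eqPQ; have exQ : exists Q : {mpoly C[n]}, Q \is symmetric /\
  peval P (@alphabet C n) = peval Q (fun i => ratX C i + (ratX C i)^-1) by exists Q.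
have [_ eP] := epsilon_spec (inhabits 0) _ exQ.
by apply: peval_zeta_inj; rewrite /= -eqPQ -eP.
Qed.

Lemma Phi_oddE (P : {mpoly C[n + n + 1]}) Q : Q \is symmetric ->
    peval P (@alphabet_odd C n) = peval Q (fun i => ratX C i + (ratX C i)^-1) ->
  Phi_odd P = Q.
Proof.
move=> symQ eqPQ; have exQ : exists Q : {mpoly C[n]}, Q \is symmetric /\
  peval P (@alphabet_odd C n) = peval Q (fun i => ratX C i + (ratX C i)^-1) by exists Q.
have [_ eP] := epsilon_spec (inhabits 0) _ exQ.
by apply: peval_zeta_inj; rewrite /= -eqPQ -eP.
Qed.

End AlgebraicIndependence.

(** * The images under Phi *)

Section Images.

Variables (C : fieldType) (n : nat).

(** Phi of sp_la, respectively o_la: the same Jacobi-Trudi determinants, formed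
    with the h_k written as polynomials in the z_i. *)
Definition spz_poly b (la : seq nat) : {mpoly C[n]} :=
  if la is [::] then 1 else
  2^-1 *: \det (\matrix_(j < size la, k < size la)
    spJT (hser (zden b (fun i : 'I_n => 'X_i : {mpoly C[n]}))) la j k).

Definition oz_poly b (la : seq nat) : {mpoly C[n]} :=
  \det (\matrix_(j < size la, k < size la)
    oJT (hser (zden b (fun i : 'I_n => 'X_i : {mpoly C[n]}))) la j k).

(** Permuting the variables permutes the factors of the denominator. *)
Lemma msym_hser s b k :
  msym s (hser (zden b (fun i : 'I_n => 'X_i : {mpoly C[n]})) k) =
  hser (zden b (fun i : 'I_n => 'X_i : {mpoly C[n]})) k.
Proof.
have -> := rmorph_hser (msym s) _ k.
have -> := map_zden (msym s) b (fun i : 'I_n => 'X_i : {mpoly C[n]}).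
rewrite -[in RHS](zden_perm _ _ s).
have -> // := @eq_zden _ _ b (msym s \o (fun i : 'I_n => 'X_i : {mpoly C[n]}))
  ((fun i : 'I_n => 'X_i : {mpoly C[n]}) \o s).
move=> i /=; rewrite msymX; congr 'X_[_]; apply/mnmP => j.
by rewrite mnmE !mnm1E -(inj_eq (@perm_inj _ s)) permKV.
Qed.

Lemma spz_poly_sym b la : spz_poly b la \is symmetric.
Proof.
apply/issymP => s; rewrite /spz_poly; case: la => [|l la]; first exact: rmorph1.
by rewrite msymZ (rmorph_det_spJT _ _ (msym_hser s b)).
Qed.

Lemma oz_poly_sym b la : oz_poly b la \is symmetric.
Proof. by apply/issymP => s; rewrite /oz_poly (rmorph_det_oJT _ _ (msym_hser s b)). Qed.

Lemma peval_hser (v : 'I_n -> ratfun C n) b k :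
  peval_rm v (hser (zden b (fun i : 'I_n => 'X_i : {mpoly C[n]})) k) =
  hser (zden b v) k.
Proof.
have -> := rmorph_hser (peval_rm v) _ k.
have -> := map_zden (peval_rm v) b (fun i : 'I_n => 'X_i : {mpoly C[n]}).
have -> // := @eq_zden _ _ b
  (peval_rm v \o (fun i : 'I_n => 'X_i : {mpoly C[n]})) v.
by move=> i; rewrite /peval_rm /= mmapX mmap1U.
Qed.

Lemma peval_hsym N (v : 'I_N -> ratfun C n) k :
  peval_rm v (hsym C N k) = hser (\prod_i (1 - (v i)%:P * 'X)) k.
Proof.
case: k => d; last by rewrite rmorph0.
rewrite hsym_qser rmorph_qser rmorph1 rmorph_prod /=; congr (qser 1 _ d).
apply: eq_bigr => i _; rewrite rmorphB rmorph1 rmorphM /= map_polyC map_polyX /=.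
by rewrite mmapX mmap1U.
Qed.

Local Notation zeta := (fun i => ratX C i + (ratX C i)^-1).

Lemma alphabet_lshift i : alphabet C (lshift n i) = ratX C i.
Proof. by rewrite /alphabet (unsplitK (inl _)). Qed.

Lemma alphabet_rshift i : alphabet C (rshift n i) = (ratX C i)^-1.
Proof. by rewrite /alphabet (unsplitK (inr _)). Qed.

Lemma prod_alphabet :
  \prod_i (1 - (@alphabet C n i)%:P * 'X) = zden false zeta.
Proof.
exact: (prod_reciprocal_alphabet (@ratX_neq0 C n) alphabet_lshift alphabet_rshift).
Qed.

Lemma prod_alphabet_odd :
  \prod_i (1 - (@alphabet_odd C n i)%:P * 'X) = zden true zeta.
Proof.
apply: (prod_reciprocal_alphabet1 (@ratX_neq0 C n) alphabet_lshift alphabet_rshift) => i.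
  by rewrite /alphabet_odd (unsplitK (inl _)).
by rewrite /alphabet_odd (unsplitK (inr _)).
Qed.

Definition ratC_rm : {rmorphism C -> ratfun C n} :=
  @tofrac {mpoly C[n]} \o @mpolyC n C.

Lemma peval_scale2 N (v : 'I_N -> ratfun C n) (p : {mpoly C[N]}) :
  peval_rm v (2^-1 *: p) = 2^-1 * peval_rm v p.
Proof.
rewrite /peval_rm /= mmapZ; congr (_ * _).
by rewrite -[LHS]/(ratC_rm 2^-1) fmorphV rmorph_nat.
Qed.

Lemma peval_sp b N (al : 'I_N -> ratfun C n) la :
    \prod_i (1 - (al i)%:P * 'X) = zden b zeta ->
  peval (spfun C N la) al = peval (spz_poly b la) zeta.
Proof.
move=> alE; rewrite !pevalE /spz_poly /spfun; case: la => [|l la].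
  by rewrite !rmorph1.
rewrite !peval_scale2 (rmorph_det_spJT _ _ (peval_hser _ _)).
congr (_ * _); apply: rmorph_det_spJT => k.
by rewrite peval_hsym alE.
Qed.

Lemma peval_o b N (al : 'I_N -> ratfun C n) la :
    \prod_i (1 - (al i)%:P * 'X) = zden b zeta ->
  peval (ofun C N la) al = peval (oz_poly b la) zeta.
Proof.
move=> alE; rewrite !pevalE /oz_poly (rmorph_det_oJT _ _ (peval_hser _ _)).
rewrite /ofun; case: la => [|l la]; first by rewrite det_mx00 rmorph1.
apply: rmorph_det_oJT => k.
by rewrite peval_hsym alE.
Qed.

Lemma spzE la : spz C n la = spz_poly false la.
Proof. by apply: PhiE (spz_poly_sym _ _) (peval_sp _ prod_alphabet). Qed.

Lemma spz_oddE la : spz_odd C n la = spz_poly true la.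
Proof. by apply: Phi_oddE (spz_poly_sym _ _) (peval_sp _ prod_alphabet_odd). Qed.

Lemma ozE la : oz C n la = oz_poly false la.
Proof. by apply: PhiE (oz_poly_sym _ _) (peval_o _ prod_alphabet). Qed.

Lemma oz_oddE la : oz_odd C n la = oz_poly true la.
Proof. by apply: Phi_oddE (oz_poly_sym _ _) (peval_o _ prod_alphabet_odd). Qed.

Hypothesis two_neq0 : (2 : C) != 0.

Lemma ratfun_two_neq0 : (2 : ratfun C n) != 0.
Proof. by rewrite -(rmorph_nat ratC_rm) fmorph_eq0. Qed.

Lemma peval_spz_poly b la (v : 'I_n -> ratfun C n) : (0 < n)%N -> (size la <= n)%N ->
  peval (spz_poly b la) v * serdet v b 1 [::] = serdet v b 1 la.
Proof.
move=> n_gt0 len; rewrite -(sp_ratio v b ratfun_two_neq0 n_gt0 len) pevalE /spz_poly.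
congr (_ * _); case: la len => [|l la] len; first exact: rmorph1.
by rewrite peval_scale2 (rmorph_det_spJT _ _ (peval_hser _ _)).
Qed.

Lemma peval_oz_poly b la (v : 'I_n -> ratfun C n) : (size la <= n)%N ->
  peval (oz_poly b la) v * serdet v b (1 - 'X^2) [::] = serdet v b (1 - 'X^2) la.
Proof.
move=> len; rewrite -(o_ratio v b ratfun_two_neq0 len) pevalE /oz_poly.
by rewrite (rmorph_det_oJT _ _ (peval_hser _ _)).
Qed.

End Images.

(** * Ratios of Chebyshev determinants *)

Lemma altdet_half_Vandermonde (C : fieldType) n (X : nat -> {poly ratfun C n}) a :
    (forall m, (size (cheb_half (X m) - 'X^m)%R <= m)%N) ->
  altdet X [::] (fun k => a k / 2) =
  \prod_(j < n) \prod_(k < n | (j < k)%N) (a j - a k).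
Proof.
move=> monicX; rewrite -(det_monic_Vandermonde a monicX) /altdet; congr (\det _).
by apply/matrixP => j k; rewrite !mxE nth_nil add0n horner_half.
Qed.

Lemma altdet_Vandermonde (C : fieldType) n (X : nat -> {poly ratfun C n}) a :
    (forall m, (size (X m - 'X^m)%R <= m)%N) ->
  altdet X [::] a = \prod_(j < n) \prod_(k < n | (j < k)%N) (a j - a k).
Proof.
move=> monicX; rewrite -(det_monic_Vandermonde a monicX) /altdet; congr (\det _).
by apply/matrixP => j k; rewrite !mxE nth_nil add0n.
Qed.

Lemma altdet_serdet (C : fieldType) n (X : nat -> {poly ratfun C n}) w a b p la :
    (forall m k, (X m).[w k] = qser p (odd_factor _ b * quad (a k)) m) ->
  altdet X la w = serdet a b p la.
Proof.
by move=> XE; congr (\det _); apply/matrixP => j k; rewrite !mxE XE.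
Qed.

Lemma sum_nth_sumn la n : (size la <= n)%N ->
  (\sum_(j < n) nth 0 la j = sumn la)%N.
Proof.
elim: la n => [|l la IHla] [|n] //= len.
- by rewrite big_ord0.
- by rewrite big1 // => j _; rewrite nth_nil.
- by rewrite big_ord_recl /= IHla.
Qed.

(** By parity, row j acquires the sign (-1)^(la_j + n - j - 1). *)
Lemma altdet_chebW_opp (C : fieldType) n la (a : 'I_n -> ratfun C n) :
    (size la <= n)%N ->
  altdet chebW la (fun k => - a k / 2) =
  (-1) ^+ sumn la *
    ((-1) ^+ (\sum_(j < n) (n - j.+1)) * altdet chebV la (fun k => a k / 2)).
Proof.
move=> len; rewrite mulrA -exprD -(sum_nth_sumn len) -big_split /=.
rewrite -prodrXr.
pose d : 'rV[ratfun C n]_n := \row_j (-1) ^+ (nth 0 la j + (n - j.+1))%N.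
have -> : \prod_(j < n) (-1) ^+ (nth 0 la j + (n - j.+1))%N = \det (diag_mx d).
  by rewrite det_diag; apply: eq_bigr => j _; rewrite mxE.
rewrite -det_mulmx mul_diag_mx; congr (\det _); apply/matrixP => j k.
by rewrite !mxE mulNr chebW_opp addnBA.
Qed.

Lemma ratio_eq (F : fieldType) (q dl d0 v : F) :
  q * d0 = dl -> d0 = v -> v != 0 -> q = dl / d0 /\ dl / d0 = dl / v.
Proof. by move=> <- -> v0; rewrite mulfK. Qed.

Section MainIdentities.

Variables (C : fieldType) (n : nat).
Hypothesis two_neq0 : (2 : C) != 0.
Implicit Types (a : 'I_n -> ratfun C n) (la : seq nat).

Let F2 : (2 : ratfun C n) != 0 := ratfun_two_neq0 n two_neq0.

Lemma altdet_chebU la a :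
  altdet chebU la (fun k => a k / 2) = serdet a false 1 la.
Proof. by apply: altdet_serdet => m k; apply: chebU_qser. Qed.

Lemma altdet_chebTmonic la a :
  altdet chebTmonic la a = serdet a false (1 - 'X^2) la.
Proof. by apply: altdet_serdet => m k; apply: chebTmonic_qser. Qed.

Lemma altdet_chebU1 la a :
  altdet chebU1 la (fun k => a k / 2) = serdet a true 1 la.
Proof. by apply: altdet_serdet => m k; apply: chebU1_qser. Qed.

Lemma altdet_chebW la a :
  altdet chebW la (fun k => a k / 2) = serdet a true (1 - 'X^2) la.
Proof. by apply: altdet_serdet => m k; apply: chebW_qser. Qed.

Lemma vdm_ratX_neq0 :
  \prod_(j < n) \prod_(k < n | (j < k)%N) (ratX C j - ratX C k) != 0.
Proof.
apply/prodf_neq0 => j _; apply/prodf_neq0 => k ltjk.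
rewrite subr_eq0 tofrac_eq; apply/eqP => /(congr1 (mcoeff U_(j))).
rewrite !mcoeffX eqxx; case: eqP => [/mnmP/(_ j)|_ /eqP]; last by rewrite oner_eq0.
by rewrite !mnm1E eqxx; case: eqP => // ekj; rewrite ekj ltnn in ltjk.
Qed.

Theorem Chebyshev_ratios la (hn : (1 <= n)%N) (hlen : (size la <= n)%N) :
  let z : 'I_n -> ratfun C n := @ratX C n in
  let w : 'I_n -> ratfun C n := fun k => z k / 2 in
  let vdm : ratfun C n :=
    \prod_(j < n) \prod_(k < n | (j < k)%N) (z j - z k) in
  [/\ peval (spz C n la) z
        = altdet chebU la w / altdet chebU [::] w
      /\ altdet chebU la w / altdet chebU [::] w
        = altdet chebU la w / vdm,
      peval (oz C n la) z
        = altdet chebTmonic la z / altdet chebTmonic [::] z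
      /\ altdet chebTmonic la z / altdet chebTmonic [::] z
        = altdet chebTmonic la z / vdm,
      peval (spz_odd C n la) z
        = altdet chebU1 la w / altdet chebU1 [::] w
      /\ altdet chebU1 la w / altdet chebU1 [::] w
        = altdet chebU1 la w / vdm,
      peval (oz_odd C n la) z
        = altdet chebW la w / altdet chebW [::] w
      /\ altdet chebW la w / altdet chebW [::] w
        = altdet chebW la w / vdm
    & (-1) ^+ sumn la * peval (oz_odd C n la) (fun k => - z k)
        = altdet chebV la w / altdet chebV [::] w
      /\ altdet chebV la w / altdet chebV [::] w
        = altdet chebV la w / vdm ].
Proof.
move=> z w vdm; split; apply: ratio_eq vdm_ratX_neq0.
- by rewrite spzE !altdet_chebU peval_spz_poly.
- exact/altdet_half_Vandermonde/monic_chebU.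
- by rewrite ozE !altdet_chebTmonic peval_oz_poly.
- exact/altdet_Vandermonde/monic_chebTmonic.
- by rewrite spz_oddE !altdet_chebU1 peval_spz_poly.
- exact/altdet_half_Vandermonde/monic_chebU1.
- by rewrite oz_oddE !altdet_chebW peval_oz_poly.
- exact/altdet_half_Vandermonde/monic_chebW.
(* Both alternants acquire the sign of the staircase, which cancels. *)
- rewrite oz_oddE; have := peval_oz_poly two_neq0 true (fun k => - z k) hlen.
  rewrite -!altdet_chebW.
  rewrite !altdet_chebW_opp //= mul1r.
  set q := peval _ _; set s := (-1) ^+ (\sum_(j < n) _)%N.
  rewrite mulrCA [RHS]mulrCA => /(mulfI _) e.
  by rewrite -mulrA e ?signr_eq0 // mulrA -exprD addnn -signr_odd odd_double mul1r.
- exact/altdet_half_Vandermonde/monic_chebV.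
Qed.

End MainIdentities.

Theorem theorem1p3 (R : realType) (n : nat) (hn : (1 <= n)%N) (la : seq nat)
    (hla : is_part la) (hlen : (size la <= n)%N) :
  let z : 'I_n -> ratfun R[i] n := @ratX R[i] n in
  let w : 'I_n -> ratfun R[i] n := fun k => z k / 2 in
  let vdm : ratfun R[i] n :=
    \prod_(j < n) \prod_(k < n | (j < k)%N) (z j - z k) in
  [/\ peval (spz R[i] n la) z
        = altdet chebU la w / altdet chebU [::] w
      /\ altdet chebU la w / altdet chebU [::] w
        = altdet chebU la w / vdm,
      peval (oz R[i] n la) z
        = altdet chebTmonic la z / altdet chebTmonic [::] z
      /\ altdet chebTmonic la z / altdet chebTmonic [::] z
        = altdet chebTmonic la z / vdm,
      peval (spz_odd R[i] n la) z
        = altdet chebU1 la w / altdet chebU1 [::] w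
      /\ altdet chebU1 la w / altdet chebU1 [::] w
        = altdet chebU1 la w / vdm,
      peval (oz_odd R[i] n la) z
        = altdet chebW la w / altdet chebW [::] w
      /\ altdet chebW la w / altdet chebW [::] w
        = altdet chebW la w / vdm
    & (-1) ^+ sumn la * peval (oz_odd R[i] n la) (fun k => - z k)
        = altdet chebV la w / altdet chebV [::] w
      /\ altdet chebV la w / altdet chebV [::] w
        = altdet chebV la w / vdm ].
Proof. by apply: Chebyshev_ratios; rewrite ?Num.Theory.pnatr_eq0. Qed.
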